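(* Let $d\in\mathbb N$ be a constant and let $0\le\delta<1$, $0\le\alpha\le 1$ and $\beta$ be constants. Let $s=n^{-(d-1)+\delta+o(1)}$, $p=n^{-1+\alpha+o(1)}\le 1$, $q=n^{-1+\beta+o(1)}\le p$, and let $\mathbb P=\mathbb P_n$ (noisy projection model) and $\mathbb Q=\mathbb Q_n$ (Erdős–Rényi model with edge density $q$) be as defined in the context. For a graph $A$ on $[n]$ let $f(A)=\sum_{1\le i<j\le n}\mathbf 1_{\{(i,j)\in A\}}$ be its number of edges. Suppose that $\beta<2(\delta+\alpha)-1$. Then, as $n\to\infty$, $$\mathbb P\Big(f(A)>q\tbinom n2+\tfrac12 ps\cdot\tbinom d2\tbinom nd\Big)=1-o(1),\qquad \mathbb Q\Big(f(A)<q\tbinom n2+\tfrac12 ps\cdot\tbinom d2\tbinom nd\Big)=1-o(1).$$ In particular, the thresholding statistic on $f(A)$ (the test that outputs $1$ if $f(A)>q\binom n2+\frac12 ps\binom d2\binom nd$ and $0$ otherwise) achieves strong detection between $\mathbb P$ and $\mathbb Q$.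
   Context: Model. $\operatorname U_{n,d}$ is the collection of all $d$-element subsets of $[n]=\{1,\dots,n\}$. The random $d$-uniform hypergraph $\mathcal H\sim\mu$ on $[n]$ includes each $\Psi\in \operatorname U_{n,d}$ independently with probability $s$. The projection $\mathcal P(\mathcal H)$ is the graph on $[n]$ in which an unordered pair $(i,j)$, $i\ne j$, is an edge if and only if some $\Psi\in\mathcal H$ contains both $i$ and $j$. Under $\mathbb P$: first sample $\mathcal H\sim\mu$; then, conditionally on $\mathcal H$, the random graph $A$ on $[n]$ includes, independently over pairs, each pair $(i,j)\in\mathcal P(\mathcal H)$ with probability $p$ and each pair $(i,j)\notin\mathcal P(\mathcal H)$ with probability $q$. Under $\mathbb Q$, $A$ is an Erdős–Rényi graph on $[n]$ with each edge present independently with probability $q$. Strong detection: a test $\phi=\phi(A)\in\{0,1\}$ achieves strong detection between $\mathbb P$ and $\mathbb Q$ if $\mathbb P(\phi(A)=0)+\mathbb Q(\phi(A)=1)=o(1)$ as $n\to\infty$. All asymptotics are as $n\to\infty$ with $d,\alpha,\beta,\delta$ fixed.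
   Formalization: The claim fails in boundary cases (e.g. p = q), so it is proved for d ≥ 2, assuming also, if β = α, that q ≤ cp for large n with some constant c < 1/2, and, if δ = α = 0, that ps·C(n,d) → ∞. *)

(* Defs.v *)
From HB Require Import structures.
From mathcomp Require Import all_boot all_order all_algebra.
From mathcomp Require Import all_classical all_reals all_analysis.
Set Implicit Arguments.
Unset Strict Implicit.
Unset Printing Implicit Defensive.
Import Order.TTheory GRing.Theory Num.Theory.
Import numFieldNormedType.Exports.
Local Open Scope classical_set_scope.
Local Open Scope ring_scope.

Definition subsets_of_size (n k : nat) : {set {set 'I_n}} :=
  [set e : {set 'I_n} | #|e| == k].

(* Families of subsets of 'I_n (the vertex set [n], shifted to start at 0):
   d-uniform hypergraphs are families of d-subsets, graphs are families of
   2-subsets.  The laws below vanish off the relevant families. *)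
Definition subset_family (n : nat) := {set {set 'I_n}}.

Definition projection (n : nat) (H : subset_family n) : subset_family n :=
  [set e in subsets_of_size n 2 | [exists Psi in H, e \subset Psi]].

(* Mass function of the random subfamily of E containing each e in E
   independently with probability w e. *)
Definition indep_law (R : realType) (n : nat) (E : subset_family n)
    (w : {set 'I_n} -> R) (F : subset_family n) : R :=
  if F \subset E then \prod_(e in E) (if e \in F then w e else 1 - w e) else 0.

Definition hypergraph_law (R : realType) (n d : nat) (s : R) :
    subset_family n -> R :=
  indep_law (subsets_of_size n d) (fun=> s).

Definition noise_law (R : realType) (n : nat) (p q : R) (H : subset_family n) :
    subset_family n -> R :=
  indep_law (subsets_of_size n 2)
    (fun e => if e \in projection H then p else q).

Definition noisy_projection_law (R : realType) (d : nat) (s p q : R) (n : nat)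
    (A : subset_family n) : R :=
  \sum_(H : subset_family n) hypergraph_law d s H * noise_law p q H A.

Definition erdos_renyi_law (R : realType) (q : R) (n : nat) :
    subset_family n -> R :=
  indep_law (subsets_of_size n 2) (fun=> q).

Definition Pr (R : realType) (n : nat) (law : subset_family n -> R)
    (event : pred (subset_family n)) : R :=
  \sum_(A : subset_family n | event A) law A.

Definition edge_count (n : nat) (A : subset_family n) : nat :=
  (\sum_(i < n) \sum_(j < n | i < j) ([set i; j]%SET \in A))%N.

Definition edge_threshold (R : realType) (n d : nat) (s p q : R) : R :=
  q * 'C(n, 2)%:R + 2^-1 * (p * s) * ('C(d, 2)%:R * 'C(n, d)%:R).

Definition edge_test (R : realType) (d : nat) (s p q : nat -> R) (n : nat)
    (A : subset_family n) : bool :=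
  edge_threshold n d (s n) (p n) (q n) < (edge_count A)%:R.

Definition strong_detection (R : realType)
    (P Q : forall n, subset_family n -> R)
    (phi : forall n, subset_family n -> bool) : Prop :=
  (fun n => Pr (P n) (fun A => phi n A == false) +
            Pr (Q n) (fun A => phi n A == true)) @ \oo --> (0 : R).

(* u n = n^(a + o(1)).  The equation is only required eventually, since it
   carries no meaning at n = 0, 1. *)
Definition power_law (R : realType) (u : nat -> R) (a : R) : Prop :=
  exists2 eps : nat -> R, eps @ \oo --> (0 : R) &
    \forall n \near \oo, u n = n%:R `^ (a + eps n).

(* Main.v *)
(* Second-moment method for the edge count f.  With mu = p s C(d,2) C(n,d), each
   pair lies in K = C(n-2,d-2) potential hyperedges and K s -> 0, so it is
   projected with probability r ~ K s; hence E_P f - q C(n,2) ~ (p - q) mu / p,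
   which exceeds mu/2 by a constant multiple of mu.  Under Q the variance is at
   most q C(n,2).  Under P, conditioning on H bounds it by
   E_P f + (p - q)^2 Var |P(H)|, and the covariance of the indicators of two
   pairs e, e' being projected is at most s times the number of d-sets containing
   both, so double counting gives Var |P(H)| <= s C(d,2)^2 C(n,d).  By Chebyshev
   both errors are O(q C(n,2) / mu^2 + 1 / mu), where beta < 2 (delta + alpha) - 1
   makes the first term vanish. *)
Require Import Defs.
From HB Require Import structures.
From mathcomp Require Import all_boot all_order all_algebra.
From mathcomp Require Import all_classical all_reals all_analysis.
From mathcomp Require Import ring lra zify.
Import Order.TTheory GRing.Theory Num.Theory.
Import numFieldNormedType.Exports.
Local Open Scope classical_set_scope.
Local Open Scope ring_scope.

Set Implicit Arguments.
Unset Strict Implicit.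
Unset Printing Implicit Defensive.

(** * Expectations under a mass function and moments of independent families *)

Definition mean (R : realType) (n : nat) (law : subset_family n -> R)
  (X : subset_family n -> R) : R := \sum_(A : subset_family n) law A * X A.

Section Mean.
Context {R : realType} {n : nat}.
Implicit Types (law X Y : subset_family n -> R) (E F S : subset_family n).
Implicit Types (w : {set 'I_n} -> R).

Lemma meanD law X Y :
  mean law (fun A => X A + Y A) = mean law X + mean law Y.
Proof. by rewrite /mean -big_split; apply: eq_bigr => A _; rewrite mulrDr. Qed.

Lemma meanZ law c X :
  mean law (fun A => c * X A) = c * mean law X.
Proof. by rewrite /mean mulr_sumr; apply: eq_bigr => A _; rewrite mulrCA. Qed.

Lemma mean_sum law (I : finType) (P : pred I)
    (X : I -> subset_family n -> R) :
  mean law (fun A => \sum_(i | P i) X i A)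
  = \sum_(i | P i) mean law (X i).
Proof.
rewrite /mean exchange_big; apply: eq_bigr => A _.
by rewrite mulr_sumr.
Qed.

Lemma le_mean law X Y : (forall A, 0 <= law A) ->
  (forall A, X A <= Y A) -> mean law X <= mean law Y.
Proof.
by move=> law0 XY; apply: ler_sum => A _; rewrite ler_wpM2l.
Qed.

Lemma PrC law (ev : pred (subset_family n)) :
  Pr law ev = mean law (fun=> 1) - Pr law (predC ev).
Proof.
rewrite /mean /Pr (bigID ev xpredT)/= -addrA.
under eq_bigr do rewrite mulr1; under [X in _ + (X - _)]eq_bigr do rewrite mulr1.
by rewrite subrr addr0.
Qed.

Lemma Pr_ge0 law (ev : pred (subset_family n)) :
  (forall A, 0 <= law A) -> 0 <= Pr law ev.
Proof. by move=> law0; apply: sumr_ge0. Qed.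

(** Markov's inequality for the squared deviation. It is stated for any event forcing a deviation of
    at least [t], so that one-sided failure events fit directly. *)
Lemma chebyshev_Pr law (ev : pred (subset_family n)) X m t :
  (forall A, 0 <= law A) -> 0 < t ->
  (forall A, ev A -> t <= `|X A - m|) ->
  Pr law ev <= mean law (fun A => (X A - m) ^+ 2) / t ^+ 2.
Proof.
move=> law0 t0 evt; rewrite ler_pdivlMr ?exprn_gt0// /Pr mulr_suml.
rewrite /mean [leRHS](bigID ev)/= -[leLHS]addr0 lerD//.
  apply: ler_sum => A /evt tX; apply: ler_wpM2l => //.
  by rewrite -[leRHS]real_normK ?num_real// lerXn2r// nnegrE// ltW.
by apply: sumr_ge0 => A _; rewrite mulr_ge0 ?sqr_ge0.
Qed.

Lemma indep_law_ge0 E w F : (forall e, 0 <= w e <= 1) -> 0 <= indep_law E w F.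
Proof.
move=> w01; rewrite /indep_law; case: ifP => // _; apply: prodr_ge0 => e _.
by case: ifP => _; have /andP[] := w01 e; rewrite ?subr_ge0.
Qed.

(** Distributivity: expanding a product over [e] of two-term sums gives one summand per family,
    namely the set of [e] at which the first term is chosen. *)
Lemma mean_indep_prod E w (g : {set 'I_n} -> bool -> R) :
  mean (indep_law E w) (fun F => \prod_(e in E) g e (e \in F))
  = \prod_(e in E) (w e * g e true + (1 - w e) * g e false).
Proof.
(* Outside [E] the two terms are 0 and 1, which kills exactly the families not contained in [E]. *)
transitivity (\prod_e ((if e \in E then w e * g e true else 0)
                     + (if e \in E then (1 - w e) * g e false else 1))).
  rewrite bigA_distr; apply: eq_bigr => F _; rewrite /indep_law.
  case: ifPn => [FE|/fintype.subsetPn[e eF eE]].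
    rewrite -big_split/= big_mkcond; apply: eq_bigr => e _.
    case: (boolP (e \in E)) => eE; case: (boolP (e \in F)) => // eF.
    by move: eE; rewrite (fintype.subsetP FE _ eF).
  by rewrite mul0r (bigD1 e)//= eF (negbTE eE) mul0r.
rewrite [RHS]big_mkcond; apply: eq_bigr => e _.
by case: ifP => // _; rewrite add0r.
Qed.

(** Factors off [S] are replaced by 1 and each averages to [w e + (1 - w e) = 1]. *)
Lemma mean_indep_prod_sub E w S (g : {set 'I_n} -> bool -> R) :
  S \subset E ->
  mean (indep_law E w) (fun F => \prod_(e in S) g e (e \in F))
  = \prod_(e in S) (w e * g e true + (1 - w e) * g e false).
Proof.
move=> SE; pose g' e b := if e \in S then g e b else 1.
have toE (h : {set 'I_n} -> R) :
    \prod_(e in S) h e = \prod_(e in E) (if e \in S then h e else 1).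
  rewrite big_mkcond [RHS]big_mkcond; apply: eq_bigr => e _.
  by case: ifP => [/(fintype.subsetP SE)->|_]; rewrite ?if_same.
transitivity (mean (indep_law E w)
   (fun F => \prod_(e in E) g' e (e \in F))).
  by apply: eq_bigr => F _; rewrite toE.
rewrite mean_indep_prod toE; apply: eq_bigr => e _.
by rewrite /g'; case: ifP => // _; ring.
Qed.

Lemma mean_indep1 E w : mean (indep_law E w) (fun=> 1) = 1.
Proof.
have := @mean_indep_prod_sub E w finset.set0 (fun _ _ => 1) (finset.sub0set _).
by rewrite !finset.big_set0.
Qed.

Lemma mean_indep_cst E w c : mean (indep_law E w) (fun=> c) = c.
Proof.
rewrite -[RHS]mulr1 -(mean_indep1 E w) -meanZ.
by apply: eq_bigr => F _; rewrite mulr1.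
Qed.

(** Variance plus squared bias. The centre [m] is arbitrary because, given the hypergraph, the edge
    count is compared with its unconditional mean. *)
Lemma mean_indep_sqr E w m :
  mean (indep_law E w)
    (fun F => (\sum_(e in E) (e \in F)%:R - m) ^+ 2)
  = \sum_(e in E) w e * (1 - w e) + (\sum_(e in E) w e - m) ^+ 2.
Proof.
set W := \sum_(e in E) w e.
pose a e (F : subset_family n) : R := (e \in F)%:R - w e.
have Ea e : e \in E -> mean (indep_law E w) (a e) = 0.
  move=> eE.
  have /(_ _)/= := @mean_indep_prod_sub E w [set e]%SET
    (fun e b => b%:R - w e).
  rewrite finset.sub1set finset.big_set1 => /(_ eE) h.
  transitivity (w e * (true%:R - w e) + (1 - w e) * (false%:R - w e)).
    by rewrite -h; apply: eq_bigr => F _; rewrite finset.big_set1.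
  by rewrite /=; ring.
have Eaa e f : e \in E -> f \in E -> mean (indep_law E w)
    (fun F => a e F * a f F) = if f == e then w e * (1 - w e) else 0.
  move=> eE fE; case: eqVneq => [->|fe].
    have := @mean_indep_prod_sub E w [set e]%SET
      (fun e b => (b%:R - w e) * (b%:R - w e)).
    rewrite finset.sub1set finset.big_set1 => /(_ eE) h.
    transitivity (w e * ((true%:R - w e) * (true%:R - w e))
        + (1 - w e) * ((false%:R - w e) * (false%:R - w e))).
      by rewrite -h; apply: eq_bigr => F _; rewrite finset.big_set1.
    by rewrite /=; ring.
  have := @mean_indep_prod_sub E w [set e; f]%SET
    (fun e b => b%:R - w e).
  rewrite finset.subUset !finset.sub1set eE fE.
  rewrite finset.big_setU1/= ?inE 1?eq_sym// finset.big_set1.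
  move=> /(_ isT) h.
  transitivity ((w e * (true%:R - w e) + (1 - w e) * (false%:R - w e)) *
    (w f * (true%:R - w f) + (1 - w f) * (false%:R - w f))); last first.
    by rewrite /=; ring.
  rewrite -h; apply: eq_bigr => F _.
  by rewrite finset.big_setU1/= ?inE 1?eq_sym// finset.big_set1.
(* The square is expanded around the true mean [W]: the linear term averages to 0, and independence
   leaves only the diagonal of the double sum. *)
transitivity (mean (indep_law E w) (fun F =>
    \sum_(e in E) \sum_(f in E) a e F * a f F
    + (2 * (W - m) * \sum_(e in E) a e F + (W - m) ^+ 2))).
  apply: eq_bigr => F _; congr (_ * _).
  have -> : \sum_(e in E) \sum_(f in E) a e F * a f F = (\sum_(e in E) a e F) ^+ 2.
    by rewrite expr2 mulr_suml; apply: eq_bigr => e _; rewrite mulr_sumr.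
  by rewrite /a sumrB -/W; ring.
rewrite !meanD meanZ mean_indep_cst !mean_sum.
under eq_bigr => e eE.
  rewrite mean_sum (bigD1 e eE)/= (Eaa _ _ eE eE) eqxx big1 ?addr0; last first.
    by move=> f /andP[fE /negbTE fe]; rewrite Eaa// fe.
  over.
by rewrite [\sum_(i in E) mean _ (a i)]big1 ?mulr0 ?add0r// => e /Ea.
Qed.

End Mean.

(** * Double counting of pairs and hyperedges *)

Section Counting.
Context {n : nat}.
Implicit Types (e Psi : {set 'I_n}) (A H S : subset_family n).

Lemma card_subsets_of_size k : #|subsets_of_size n k| = 'C(n, k).
Proof. by rewrite card_draws card_ord. Qed.

(** Ordered pairs with [i < j] biject with 2-subsets; this form matches the index set of the
    laws. *)
Lemma edge_countE A :
  edge_count A = (\sum_(e in subsets_of_size n 2) (e \in A))%N.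
Proof.
pose pr (x : 'I_n * 'I_n) := [set x.1; x.2]%SET.
pose O := [set x : 'I_n * 'I_n | (x.1 < x.2)%N]%SET.
have pr_inj : {in O &, injective pr}.
  move=> [a b] [a' b']; rewrite !inE/= => ab ab' /setP eqs.
  have := eqs a; have := eqs b; have := eqs a'; have := eqs b'.
  rewrite !inE !eqxx ?orbT/=.
  move=> /orP[] /eqP ? /orP[] /eqP ? /esym/orP[] /eqP ? /esym/orP[] /eqP ?;
  subst => //; by [rewrite ltnn in ab| rewrite ltnn in ab'|
    have := ltn_trans ab ab'; rewrite ltnn].
have -> : subsets_of_size n 2 = (pr @: O)%SET.
  apply/setP => e; rewrite inE; apply/cards2P/imsetP => [[x [y [xy ->]]]|].
    have [lxy|lyx|/val_inj xy'] := ltngtP x y.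
    - by exists (x, y); rewrite // inE.
    - by exists (y, x); rewrite ?inE// /pr/= finset.setUC.
    - by rewrite xy' eqxx in xy.
  move=> [[x y]]; rewrite inE/= => xy ->; exists x, y; split=> //.
  by apply: contraTneq xy => ->; rewrite ltnn.
rewrite big_imset// /edge_count pair_big_dep.
by apply: eq_bigl => x; rewrite inE.
Qed.

Definition supersets d e : subset_family n :=
  [set Psi in subsets_of_size n d | e \subset Psi].

(** Adjoining [e] is a bijection from the (d-2)-subsets of the complement of [e], with inverse
    removing [e]. *)
Lemma card_supersets d e : (2 <= d)%N -> e \in subsets_of_size n 2 ->
  #|supersets d e| = 'C(n - 2, d - 2).
Proof.
rewrite inE => d2 /eqP e2.
have -> : (n - 2)%N = #|~: e|%SET by rewrite cardsCs finset.setCK e2 card_ord.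
rewrite -cards_draws -(card_in_imset (f := fun B => e :|: B)%SET).
  apply: eq_card => Psi; rewrite !inE; apply/andP/imsetP => [[/eqP dPsi ePsi]|[B]].
    exists (Psi :\: e)%SET; last by rewrite -{1}(finset.setID Psi e) (finset.setIidPr ePsi).
    rewrite inE finset.setDE finset.subsetIr/= -finset.setDE cardsD.
    by rewrite (finset.setIidPr ePsi) e2 dPsi.
  rewrite inE => /andP[Be /eqP cB] ->; rewrite finset.subsetUl cardsU cB e2.
  have -> : (e :&: B)%SET = finset.set0.
    by apply/eqP; rewrite finset.setIC setI_eq0 finset.disjoints_subset.
  by rewrite cards0 subn0 subnKC.
move=> B C; rewrite !inE => /andP[Be _] /andP[Ce _] eBC.
have dE (D : {set 'I_n}) : D \subset (~: e)%SET -> ((e :|: D) :\: e)%SET = D.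
  move=> De; rewrite finset.setDUl finset.setDv finset.set0U finset.setDE.
  exact/finset.setIidPl.
by rewrite -(dE _ Be) -(dE _ Ce) eBC.
Qed.

Lemma card_pairs_inside d Psi : Psi \in subsets_of_size n d ->
  (\sum_(e in subsets_of_size n 2) (e \subset Psi))%N = 'C(d, 2).
Proof.
rewrite inE => /eqP <-; rewrite -cards_draws -sum1_card big_mkcond.
rewrite [RHS]big_mkcond; apply: eq_bigr => e _; rewrite !inE andbC.
by case: (_ == _); case: (_ \subset _).
Qed.

Lemma sum_card_supersets d :
  (\sum_(e in subsets_of_size n 2) #|supersets d e|)%N
  = ('C(d, 2) * 'C(n, d))%N.
Proof.
transitivity (\sum_(e in subsets_of_size n 2)
    \sum_(Psi in subsets_of_size n d) (e \subset Psi))%N.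
  apply: eq_bigr => e _; rewrite -sum1_card big_mkcond [RHS]big_mkcond/=.
  by apply: eq_bigr => Psi _; rewrite inE; case: (_ \in _); case: (_ \subset _).
rewrite exchange_big/= (eq_bigr _ (@card_pairs_inside d)) sum_nat_const.
by rewrite card_subsets_of_size mulnC.
Qed.

(** Counts triples of a hyperedge and an ordered choice of two pairs inside it. This sum will bound
    the total covariance of the projected pairs. *)
Lemma sum_card_supersetsI d :
  (\sum_(e in subsets_of_size n 2) \sum_(f in subsets_of_size n 2)
     #|supersets d e :&: supersets d f|)%N
  = ('C(d, 2) ^ 2 * 'C(n, d))%N.
Proof.
transitivity (\sum_(e in subsets_of_size n 2) \sum_(f in subsets_of_size n 2)
    \sum_(Psi in subsets_of_size n d) ((e \subset Psi) * (f \subset Psi)))%N.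
  apply: eq_bigr => e _; apply: eq_bigr => f _.
  rewrite -sum1_card big_mkcond [RHS]big_mkcond/=.
  apply: eq_bigr => Psi _; rewrite !inE.
  by case: (_ == _); case: (_ \subset _); case: (_ \subset _).
under eq_bigr do rewrite exchange_big/=.
rewrite exchange_big/=.
rewrite (eq_bigr (fun=> 'C(d, 2) ^ 2))%N.
  by rewrite sum_nat_const card_subsets_of_size mulnC.
move=> Psi dPsi; rewrite expnS expn1 -{1}(card_pairs_inside dPsi) big_distrl/=.
by apply: eq_bigr => e _; rewrite -big_distrr/= (card_pairs_inside dPsi).
Qed.

(** Turns non-projection into the event that [H] avoids a fixed family, whose probability is a power
    of [1 - s]. *)
Lemma in_projection d H e : H \subset subsets_of_size n d ->
  e \in subsets_of_size n 2 ->
  (e \in projection H) = (supersets d e :&: H != finset.set0)%SET.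
Proof.
move=> Hd e2; rewrite inE e2/=.
apply/existsP/set0Pn => [[Psi /andP[PH eP]]|[Psi]].
  by exists Psi; rewrite finset.inE PH inE eP (fintype.subsetP Hd).
by rewrite !inE => /andP[/andP[_ eP] PH]; exists Psi; rewrite PH eP.
Qed.

End Counting.

(** * Bernoulli inequalities *)

Section Bernoulli.
Context {R : realDomainType}.

Lemma bernoulli_exprDn (x : R) k : 0 <= x -> 1 + k%:R * x <= (1 + x) ^+ k.
Proof.
move=> x0; elim: k => [|k IH]; first by rewrite mul0r addr0 expr0.
rewrite exprS; apply: le_trans (_ : (1 + x) * (1 + k%:R * x) <= _).
  rewrite -natr1; have : 0 <= k%:R * x * x by rewrite !mulr_ge0.
  by lra.
by rewrite ler_wpM2l// addr_ge0.
Qed.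

Lemma bernoulli_exprBn (x : R) k : 0 <= x <= 1 -> 1 - (1 - x) ^+ k <= k%:R * x.
Proof.
move=> /andP[x0 x1]; elim: k => [|k IH]; first by rewrite expr0 mul0r subrr.
have : (1 - x) * (1 - (1 - x) ^+ k) <= 1 - (1 - x) ^+ k.
  by rewrite ler_piMl ?gerBl// subr_ge0 exprn_ile1// ?subr_ge0 ?gerBl.
by rewrite exprS -natr1; lra.
Qed.

End Bernoulli.

(** * Mean and variance of the number of projected pairs *)

Section ProjectionMoments.
Context {R : realType} {n d : nat} (s : R).
Hypothesis s01 : 0 <= s <= 1.
Implicit Types (e f : {set 'I_n}) (H S : subset_family n).

Let hyp := @hypergraph_law R n d s.

Lemma mean_avoids S : S \subset subsets_of_size n d ->
  mean hyp (fun H => (S :&: H == finset.set0)%SET%:R) = (1 - s) ^+ #|S|.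
Proof.
move=> Sd.
have := @mean_indep_prod_sub R n (subsets_of_size n d) (fun=> s) S
  (fun _ b => (~~ b)%:R) Sd.
under [RHS]eq_bigr do rewrite mulr0 mulr1 add0r.
rewrite prodr_const => <-; apply: eq_bigr => H _; congr (_ * _).
case: eqVneq => [SH|/set0Pn[Psi]]; last first.
  by rewrite inE => /andP[PS PH]; rewrite (bigD1 Psi)//= PH mul0r.
rewrite big1// => Psi PS; case: (boolP (_ \in H)) => // PH.
by have := finset.in_set0 Psi; rewrite -SH finset.inE PS PH.
Qed.

Lemma mean_hyp_ext (X Y : subset_family n -> R) :
  (forall H, H \subset subsets_of_size n d -> X H = Y H) ->
  mean hyp X = mean hyp Y.
Proof.
move=> XY; apply: eq_bigr => H _; rewrite /hyp /hypergraph_law /indep_law.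
by case: ifP => [/XY->//|_]; rewrite !mul0r.
Qed.

Let K := 'C(n - 2, d - 2).
Let r := 1 - (1 - s) ^+ K.

Hypothesis d2 : (2 <= d)%N.

Lemma supersets_sub e : supersets d e \subset subsets_of_size n d.
Proof. by apply/fintype.subsetP => Psi; rewrite inE => /andP[]. Qed.

Lemma mean_in_projection e : e \in subsets_of_size n 2 ->
  mean hyp (fun H => (e \in projection H)%:R) = r.
Proof.
move=> e2.
transitivity (mean hyp
    (fun H => 1 + (- 1) * (supersets d e :&: H == finset.set0)%SET%:R)).
  apply: mean_hyp_ext => H Hd; rewrite (in_projection Hd e2).
  by case: (_ == _); rewrite /= ?mulr1 ?mulr0 ?addr0 ?subrr.
rewrite meanD meanZ mean_indep1 mean_avoids.
  by rewrite card_supersets// mulN1r.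
exact: supersets_sub.
Qed.

(** With [u] and [v] the sizes of the union and intersection of the two superset families,
    [u + v = 2K], so the covariance is [(1 - s)^u (1 - (1 - s)^v)], at most [v s] by Bernoulli. *)
Lemma covariance_in_projection e f :
  e \in subsets_of_size n 2 -> f \in subsets_of_size n 2 ->
  mean hyp (fun H =>
    ((e \in projection H)%:R - r) * ((f \in projection H)%:R - r))
  <= s * #|supersets d e :&: supersets d f|%SET%:R.
Proof.
move=> e2 f2; set v := #|_|.
pose Z (S : subset_family n) H : R := (S :&: H == finset.set0)%SET%:R.
(* Each centred indicator equals [(1 - s)^K] minus an avoidance indicator, and avoiding both
   families means avoiding their union. *)
have -> : mean hyp (fun H =>
    ((e \in projection H)%:R - r) * ((f \in projection H)%:R - r)) =
  mean hyp (fun H => Z (supersets d e :|: supersets d f)%SET H +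
     (- (1 - s) ^+ K * (Z (supersets d e) H) +
     (- (1 - s) ^+ K * (Z (supersets d f) H) + (1 - s) ^+ K * (1 - s) ^+ K))).
  apply: mean_hyp_ext => H Hd; rewrite !(in_projection Hd)//.
  rewrite /Z finset.setIUl finset.setU_eq0 /r.
  by do 2!case: (_ == _); rewrite /=; ring.
rewrite !meanD !meanZ mean_indep_cst.
rewrite !mean_avoids ?supersets_sub ?finset.subUset ?supersets_sub//.
rewrite !card_supersets// -/K.
have uv : (#|supersets d e :|: supersets d f|%SET + v = K + K)%N.
  by rewrite cardsUI !card_supersets.
set u := #|_|%SET in uv *.
suff : (1 - s) ^+ u - (1 - s) ^+ (u + v) <= s * v%:R.
  rewrite uv exprD; move: ((1 - s) ^+ u) ((1 - s) ^+ K) (s * _) => a b c; lra.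
have /andP[s0 s1] := s01.
rewrite exprD -[X in X - _]mulr1 -mulrBr.
apply: le_trans (_ : 1 - (1 - s) ^+ v <= _).
  rewrite ler_piMl ?subr_ge0 ?exprn_ile1 ?subr_ge0 ?gerBl//.
by rewrite mulrC bernoulli_exprBn.
Qed.

Lemma variance_projection :
  mean hyp (fun H =>
    (\sum_(e in subsets_of_size n 2) (e \in projection H)%:R
     - r * 'C(n, 2)%:R) ^+ 2)
  <= s * ('C(d, 2)%:R ^+ 2 * 'C(n, d)%:R).
Proof.
rewrite [leLHS](_ : _ = \sum_(e in subsets_of_size n 2)
    \sum_(f in subsets_of_size n 2) mean hyp (fun H =>
    ((e \in projection H)%:R - r) * ((f \in projection H)%:R - r))); last first.
  under [RHS]eq_bigr do rewrite -mean_sum.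
  rewrite -mean_sum; apply: eq_bigr => H _; congr (_ * _).
  under [RHS]eq_bigr do rewrite -mulr_sumr.
  rewrite -mulr_suml -expr2 sumrB sumr_const card_subsets_of_size.
  by rewrite mulr_natr.
rewrite -natrX -natrM -sum_card_supersetsI natr_sum mulr_sumr.
apply: ler_sum => e e2; rewrite natr_sum mulr_sumr.
by apply: ler_sum => f f2; apply: covariance_in_projection.
Qed.

End ProjectionMoments.

(** * Chebyshev bounds under the two laws *)

Section Failure.
Context {R : realType} {n d : nat} (s p q : R).
Hypothesis s01 : 0 <= s <= 1.
Hypothesis q0 : 0 <= q.
Hypothesis qp : q <= p.
Hypothesis p1 : p <= 1.
Implicit Types (A H : subset_family n).

Local Notation N := ('C(n, 2)%:R : R).

Lemma edge_count_sum A :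
  (edge_count A)%:R = \sum_(e in subsets_of_size n 2) (e \in A)%:R :> R.
Proof. by rewrite edge_countE natr_sum. Qed.

Lemma erdos_renyi_ge0 A : 0 <= erdos_renyi_law q A.
Proof. by apply: indep_law_ge0 => _; rewrite q0 (le_trans qp). Qed.

Lemma noise_law_ge0 H A : 0 <= noise_law p q H A.
Proof.
apply: indep_law_ge0 => e; case: ifP => _; rewrite ?q0 ?(le_trans q0) ?p1//.
exact: le_trans qp p1.
Qed.

Lemma noisy_projection_ge0 A : 0 <= noisy_projection_law d s p q A.
Proof.
apply: sumr_ge0 => H _; rewrite mulr_ge0 ?noise_law_ge0//.
exact: indep_law_ge0.
Qed.

(** Tower property: average over the noise given [H], then over [H]. *)
Lemma mean_noisy (X : subset_family n -> R) :
  mean (@noisy_projection_law R d s p q n) X =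
  mean (hypergraph_law d s) (fun H => mean (noise_law p q H) X).
Proof.
rewrite /mean; under eq_bigr do rewrite mulr_suml.
rewrite exchange_big; apply: eq_bigr => H _; rewrite mulr_sumr.
by apply: eq_bigr => A _; rewrite mulrA.
Qed.

Lemma mean_noisy1 :
  mean (@noisy_projection_law R d s p q n) (fun=> 1) = 1.
Proof.
rewrite mean_noisy -[RHS](mean_indep1 (subsets_of_size n d) (fun=> s)).
by apply: eq_bigr => H _; rewrite mean_indep1.
Qed.

Lemma erdos_renyi_failure t (ev : pred (subset_family n)) : 0 < t ->
  (forall A, ev A -> q * N + t <= (edge_count A)%:R) ->
  Pr (@erdos_renyi_law R q n) ev <= q * N / t ^+ 2.
Proof.
move=> t0 evt.
apply: le_trans (chebyshev_Pr (X := fun A => (edge_count A)%:R) (m := q * N)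
  erdos_renyi_ge0 t0 _) _ => [A /evt|].
  by move=> h; rewrite ler_normr; apply/orP; left; lra.
rewrite ler_wpM2r ?invr_ge0 ?sqr_ge0//.
rewrite (_ : mean _ _ = \sum_(e in subsets_of_size n 2) q * (1 - q)); last first.
  have := mean_indep_sqr (subsets_of_size n 2) (fun=> q) (q * N).
  rewrite [X in _ = _ + (X - _) ^+ 2]sumr_const card_subsets_of_size.
  rewrite mulr_natr subrr expr0n addr0 => <-.
  by apply: eq_bigr => A _; rewrite edge_count_sum.
rewrite sumr_const card_subsets_of_size -[leLHS]mulr_natr ler_wpM2r ?ler0n//.
by rewrite ler_piMr// gerBl.
Qed.

Let r := 1 - (1 - s) ^+ 'C(n - 2, d - 2).

Hypothesis d2 : (2 <= d)%N.

(** Law of total variance: the conditional variance given [H] is at most the conditional mean [W H],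
    and [W H] deviates from [m] by [p - q] times the deviation of the number of projected pairs. *)
Lemma noisy_projection_failure t (ev : pred (subset_family n)) : 0 < t ->
  (forall A, ev A -> (edge_count A)%:R + t <= q * N + (p - q) * (r * N)) ->
  Pr (@noisy_projection_law R d s p q n) ev <=
    (q * N + (p - q) * (r * N)
     + (p - q) ^+ 2 * (s * ('C(d, 2)%:R ^+ 2 * 'C(n, d)%:R))) / t ^+ 2.
Proof.
move=> t0 evt; set m := q * N + _ in evt *.
apply: le_trans (chebyshev_Pr (X := fun A => (edge_count A)%:R) (m := m)
  noisy_projection_ge0 t0 _) _ => [A /evt|].
  by move=> h; rewrite ler_normr; apply/orP; right; lra.
rewrite ler_wpM2r ?invr_ge0 ?sqr_ge0// mean_noisy.
pose k H : R := \sum_(e in subsets_of_size n 2) (e \in projection H)%:R.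
pose W H : R := q * N + (p - q) * k H.
have WE H : \sum_(e in subsets_of_size n 2)
    (if e \in projection H then p else q) = W H.
  rewrite /W /k mulr_sumr -{1}(card_subsets_of_size 2) mulr_natr -sumr_const.
  by rewrite -big_split; apply: eq_bigr => e _; case: ifP => _ /=; ring.
have hyp0 H : 0 <= hypergraph_law d s H by apply: indep_law_ge0.
apply: le_trans (_ : mean (hypergraph_law d s) (fun H =>
    (q * N + (p - q) * k H) + (p - q) ^+ 2 * (k H - r * N) ^+ 2) <= _).
  apply: le_mean => // H.
  rewrite (_ : mean _ _ = \sum_(e in subsets_of_size n 2)
     (if e \in projection H then p else q) *
     (1 - (if e \in projection H then p else q)) + (W H - m) ^+ 2); last first.
    by rewrite -WE -mean_indep_sqr; apply: eq_bigr => A _; rewrite edge_count_sum.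
  rewrite lerD//; last first.
    by rewrite -exprMn (_ : W H - m = (p - q) * (k H - r * N))// /W /m; ring.
  rewrite -/(W H) -WE; apply: ler_sum => e _.
  by rewrite ler_piMr ?gerBl//; case: ifP => _ //; apply: le_trans qp.
rewrite !meanD !meanZ mean_indep_cst mean_sum.
rewrite (eq_bigr (fun=> r)); last by move=> e e2; rewrite mean_in_projection.
rewrite sumr_const card_subsets_of_size -[r *+ _]mulr_natr lerD2l.
by rewrite ler_wpM2l ?sqr_ge0// variance_projection.
Qed.

End Failure.

(** * Calculus of sequences of the form n^(a + o(1)) *)

Section PowerLaw.
Context {R : realType}.
Implicit Types (u v : nat -> R) (a b : R).

Lemma near_nat_gt0 : \forall n \near \oo, 0 < n%:R :> R.
Proof. exact: nbhs_infty_gtr. Qed.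

Lemma power_lawM u v a b :
  power_law u a -> power_law v b -> power_law (fun n => u n * v n) (a + b).
Proof.
move=> [e e0 ue] [f f0 vf]; exists (fun n => e n + f n).
  by rewrite -[0]addr0; apply: cvgD.
near=> n; rewrite (near ue n)// (near vf n)// -powRD; first by congr (_ `^ _); ring.
by apply/implyP => _; rewrite gt_eqF//; near: n; exact: near_nat_gt0.
Unshelve. all: by end_near. Qed.

Lemma power_lawV u a : power_law u a -> power_law (fun n => (u n)^-1) (- a).
Proof.
move=> [e e0 ue]; exists (fun n => - e n).
  by rewrite -[0]oppr0; apply: cvgN.
by near=> n; rewrite (near ue n)// -powRN opprD.
Unshelve. all: by end_near. Qed.

Lemma power_law_natX k : power_law (fun n => n%:R ^+ k : R) k%:R.
Proof.
exists (fun=> 0); first exact: cvg_cst.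
by near=> n; rewrite addr0 powR_mulrn.
Unshelve. all: by end_near. Qed.

Lemma power_law_gt0 u a : power_law u a -> \forall n \near \oo, 0 < u n.
Proof.
move=> [e e0 ue]; near=> n; rewrite (near ue n)// powR_gt0//.
by near: n; exact: near_nat_gt0.
Unshelve. all: by end_near. Qed.

Lemma natV_powR_cvg0 b : 0 < b -> (fun n => n%:R `^ (- b) : R) @ \oo --> (0 : R).
Proof.
move=> b0; apply/cvgr0Pnorm_lt => e e0.
near=> n; have n0 : 0 < n%:R :> R by near: n; exact: near_nat_gt0.
rewrite ger0_norm ?powR_ge0// powRN invf_plt ?posrE ?powR_gt0//.
(* Rewritten as a [b]-th power, the target holds as soon as [n] exceeds [e^-1] to the power
   [1/b]. *)
have -> : e^-1 = (e^-1 `^ b^-1) `^ b.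
  by rewrite -powRrM mulVf ?lt0r_neq0// powRr1// invr_ge0 ltW.
apply: gt0_ltr_powR; rewrite ?nnegrE ?powR_ge0//.
by near: n; exact: nbhs_infty_gtr.
Unshelve. all: by end_near. Qed.

(** Eventually the error in the exponent is below [-a/2], so [u n] is squeezed under [n] to the
    negative power [a/2]. *)
Lemma power_law_cvg0 u a : power_law u a -> a < 0 -> u @ \oo --> (0 : R).
Proof.
move=> [e e0 ue] a0; have a20 : 0 < - (a / 2) by lra.
apply: (squeeze_cvgr _ (cvg_cst 0) (natV_powR_cvg0 a20)).
near=> n; rewrite (near ue n)// powR_ge0/= opprK ler_powR//.
  by near: n; exact: nbhs_infty_ger.
suff : `|e n| < - (a / 2) by rewrite ltr_norml => /andP[_ ?]; lra.
by near: n; move/cvgr0Pnorm_lt : e0; apply.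
Unshelve. all: by end_near. Qed.

(** The ratio [u / v] has negative exponent [a - b], hence tends to 0 and drops below any
    [c > 0]. *)
Lemma power_law_le u v a b c :
  power_law u a -> power_law v b -> a < b -> 0 < c ->
  \forall n \near \oo, u n <= c * v n.
Proof.
move=> ua vb ab c0; have v0 := power_law_gt0 vb; have u0 := power_law_gt0 ua.
have /cvgr0Pnorm_lt /(_ _ c0) uv :
    (fun n => u n * (v n)^-1) @ \oo --> (0 : R).
  by apply: power_law_cvg0 (power_lawM ua (power_lawV vb)) _; rewrite subr_lt0.
near=> n; rewrite -ler_pdivrMr; last exact: (near v0 n).
by rewrite ltW// (le_lt_trans (ler_norm _))//; exact: (near uv n).
Unshelve. all: by end_near. Qed.

End PowerLaw.

(** * Comparison of binomial coefficients with powers *)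

Lemma ffact_leX n k : (n ^_ k <= n ^ k)%N.
Proof.
rewrite ffact_prod -[X in (n ^ X)%N]card_ord -prod_nat_const.
by apply: leq_prod => i _; exact: leq_subr.
Qed.

Lemma bin_leX n k : ('C(n, k) <= n ^ k)%N.
Proof.
by rewrite (leq_trans _ (ffact_leX n k))// -bin_ffact leq_pmulr// fact_gt0.
Qed.

(** Each factor [n - i] with [i < k] of the falling factorial is at least [n/2]. *)
Lemma expn_le_bin n k : (2 * k <= n)%N -> (n ^ k <= 2 ^ k * k`! * 'C(n, k))%N.
Proof.
move=> kn; rewrite -mulnA [(k`! * _)%N]mulnC bin_ffact ffact_prod.
rewrite -[X in (n ^ X)%N]card_ord -[X in (2 ^ X)%N](card_ord k) -!prod_nat_const.
rewrite -big_split/=; apply: leq_prod => i _.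
by have := ltn_ord i; lia.
Qed.

(** * Error bounds in terms of the expected signal *)

Section Signal.
Context {R : realType} {n d : nat} (s p q : R).
Hypothesis s01 : 0 <= s <= 1.
Hypothesis q0 : 0 <= q.
Hypothesis qp : q <= p.
Hypothesis p1 : p <= 1.
Hypothesis d2 : (2 <= d)%N.

Local Notation N := ('C(n, 2)%:R : R).
Local Notation K := ('C(n - 2, d - 2)%:R : R).

(* Union-bound approximation of the mean number of projected pairs kept in A. *)
Definition projected_edges : R := p * s * ('C(d, 2)%:R * 'C(n, d)%:R).
Local Notation mu := projected_edges.

Hypothesis mu0 : 0 < mu.

Lemma edge_thresholdE : edge_threshold n d s p q = q * N + mu / 2.
Proof. by rewrite /edge_threshold /mu; field. Qed.

(** Counting pairs inside hyperedges from either side; in this form [mu] compares directly with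
    [p r N], since [r] is close to [K s]. *)
Lemma projected_edgesE : mu = p * (K * s * N).
Proof.
have : (K * N = 'C(d, 2)%:R * 'C(n, d)%:R :> R).
  rewrite -!natrM -sum_card_supersets; congr (_%:R).
  rewrite (eq_bigr (fun=> 'C(n - 2, d - 2))).
    by rewrite sum_nat_const card_subsets_of_size mulnC.
  by move=> e; apply: card_supersets.
by rewrite /mu => <-; ring.
Qed.

Lemma erdos_renyi_error :
  Pr (@erdos_renyi_law R q n)
     (fun A => ~~ ((edge_count A)%:R < edge_threshold n d s p q))
  <= 4 * (q * N / mu ^+ 2).
Proof.
have mu2 : 0 < mu / 2 by rewrite divr_gt0.
apply: le_trans (erdos_renyi_failure q0 qp p1 mu2 _) _.
  by move=> A; rewrite -leNgt edge_thresholdE.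
by rewrite le_eqVlt; apply/orP; left; apply/eqP; field; rewrite gt_eqF.
Qed.

(* The bound on K s says exactly that (1 - c) / (1 + K s) >= 1/2 + (1/2 - c) / 2,
   which leaves a margin ((1/2 - c) / 2) mu between E_P f and the threshold. *)
Lemma noisy_projection_error c :
  c < 2^-1 -> q <= c * p -> K * s <= (4^-1 - c / 2) / (3 / 4 - c / 2) ->
  Pr (@noisy_projection_law R d s p q n)
     (fun A => ~~ (edge_threshold n d s p q < (edge_count A)%:R))
  <= ((2^-1 - c) / 2) ^- 2 * (q * N / mu ^+ 2 + (1 + 'C(d, 2)%:R) * mu^-1).
Proof.
move=> c2 qcp; set x := K * s => xeta.
have /andP[s0 s1] := s01; have p0 : 0 <= p := le_trans q0 qp.
have x0 : 0 <= x by rewrite mulr_ge0.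
have N0 : 0 <= N by [].
set tau := (2^-1 - c) / 2; have tau0 : 0 < tau by rewrite /tau; lra.
pose r := 1 - (1 - s) ^+ 'C(n - 2, d - 2).
have r_le : r <= x by apply: bernoulli_exprBn.
(* By Bernoulli, [(1 - s)^K (1 + K s)] is at most [((1 - s)(1 + s))^K], hence at most 1. *)
have r_ge : x / (1 + x) <= r.
  have x1 : 0 < 1 + x by rewrite ltr_pwDl.
  suff : (1 - s) ^+ 'C(n - 2, d - 2) * (1 + x) <= 1.
    by rewrite ler_pdivrMr// /r; move: (_ ^+ _) => a; lra.
  have s1' : 0 <= 1 - s by rewrite subr_ge0.
  apply: le_trans (_ : ((1 - s) * (1 + s)) ^+ 'C(n - 2, d - 2) <= _).
    by rewrite exprMn ler_wpM2l ?exprn_ge0// bernoulli_exprDn.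
  have ss0 : 0 <= (1 - s) * (1 + s) by rewrite mulr_ge0// addr_ge0.
  by rewrite exprn_ile1//; have := sqr_ge0 s; rewrite expr2; lra.
have p_gt0 : 0 < p.
  rewrite lt_neqAle p0 andbT; move: mu0; rewrite /mu.
  by apply: contraTneq => <-; rewrite !mul0r ltxx.
have signal : mu / 2 + tau * mu <= (p - q) * (r * N).
  have -> : mu / 2 + tau * mu = (2^-1 + tau) * mu by ring.
  (* Here [q <= c p] gives [p - q >= (1 - c) p], which is combined with the lower bound on [r]. *)
  apply: le_trans (_ : (1 - c) / (1 + x) * mu <= _).
    rewrite ler_wpM2r ?(ltW mu0)// ler_pdivlMr; last by rewrite ltr_pwDl.
    move: xeta; rewrite ler_pdivlMr; last by lra.
    rewrite /tau; move: x {x0 r_le r_ge} => x h; lra.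
  rewrite projected_edgesE -/x.
  have -> : (1 - c) / (1 + x) * (p * (x * N)) = ((1 - c) * p) * (x / (1 + x) * N).
    by ring.
  have c1 : 0 <= 1 - c by lra.
  have pqc : (1 - c) * p <= p - q by lra.
  have x1 : 0 <= x / (1 + x) by rewrite divr_ge0 ?addr_ge0.
  have xrN : x / (1 + x) * N <= r * N by rewrite ler_wpM2r.
  by apply: ler_pM => //; [rewrite mulr_ge0 | rewrite mulr_ge0].
apply: le_trans (noisy_projection_failure s01 q0 qp p1 d2 (mulr_gt0 tau0 mu0) _) _.
  move=> A; rewrite -leNgt edge_thresholdE => h.
  by apply: le_trans (lerD (lexx _) signal); rewrite addrA lerD2r.
(* The mean edge count is at most [q N + mu] because [(p - q) r <= p K s]; the projection variance
   contributes at most ['C(d, 2) mu] because [(p - q)^2 <= p^2 <= p]. *)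
apply: le_trans (_ : (q * N + mu + 'C(d, 2)%:R * mu) / (tau * mu) ^+ 2 <= _); last first.
  by rewrite le_eqVlt; apply/orP; left; apply/eqP; field; rewrite !gt_eqF.
rewrite ler_wpM2r ?invr_ge0 ?sqr_ge0//; apply: lerD.
  rewrite lerD2l projected_edgesE -/x ler_pM ?mulr_ge0 ?subr_ge0 ?gerBl//.
    by rewrite exprn_ile1// ?subr_ge0 ?gerBl.
  by rewrite ler_wpM2r.
rewrite /mu (_ : 'C(d, 2)%:R * _ = p * (s * ('C(d, 2)%:R ^+ 2 * 'C(n, d)%:R))); last by ring.
rewrite ler_wpM2r ?mulr_ge0 ?exprn_ge0//.
apply: le_trans (_ : p ^+ 2 <= _); first by rewrite lerXn2r ?nnegrE ?subr_ge0// gerBl.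
by rewrite expr2 ler_piMr.
Qed.

End Signal.

(** * Asymptotics of the error terms *)

Section Asymptotics.
Context {R : realType} (d : nat) (delta alpha beta : R) (s p q : nat -> R).
Hypothesis d2 : (2 <= d)%N.
Hypothesis hs : power_law s (- (d%:R - 1) + delta).
Hypothesis hp : power_law p (- 1 + alpha).
Hypothesis hq : power_law q (- 1 + beta).

Local Notation mu n := (@projected_edges R n d (s n) (p n)).

(** Proxy for [mu] with [n^d] in place of the binomials, making it an exact power law. *)
Let nu n := p n * s n * n%:R ^+ d.
Let c0 : R := ((2 ^ d * d`!)%:R)^-1.

Let c0_gt0 : 0 < c0.
Proof. by rewrite invr_gt0 ltr0n muln_gt0 expn_gt0 fact_gt0. Qed.

Let nu_law : power_law nu (alpha + delta).
Proof.
have -> : alpha + delta = (- 1 + alpha) + (- (d%:R - 1) + delta) + d%:R by ring.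
by apply: power_lawM (power_law_natX d); apply: power_lawM.
Qed.

Let bin_d2_ge1 : 1 <= 'C(d, 2)%:R :> R.
Proof. by rewrite ler1n bin_gt0. Qed.

(** Uses ['C(d, 2) >= 1] and, once [n >= 2d], ['C(n, d) >= c0 n^d]. *)
Lemma projected_edges_ge : \forall n \near \oo, c0 * nu n <= mu n.
Proof.
have p0 := power_law_gt0 hp; have s0 := power_law_gt0 hs.
near=> n.
have pn : 0 < p n by exact: (near p0 n).
have sn : 0 < s n by exact: (near s0 n).
rewrite /projected_edges /nu mulrCA ler_wpM2l ?mulr_ge0 ?(ltW pn) ?(ltW sn)//.
apply: le_trans (_ : 'C(n, d)%:R <= _); last by rewrite ler_peMl.
rewrite mulrC ler_pdivrMr; last by rewrite ltr0n muln_gt0 expn_gt0 fact_gt0.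
rewrite -natrX -natrM ler_nat mulnC expn_le_bin//.
by near: n; exact: nbhs_infty_ge.
Unshelve. all: by end_near. Qed.

Lemma projected_edges_gt0 : \forall n \near \oo, 0 < mu n.
Proof.
have nu0 := power_law_gt0 nu_law; near=> n.
have le_mu : c0 * nu n <= mu n by exact: (near projected_edges_ge n).
by rewrite (lt_le_trans _ le_mu)// mulr_gt0//; exact: (near nu0 n).
Unshelve. all: by end_near. Qed.

(** The majorant [q n^2 / nu^2] has exponent [beta + 1 - 2 (delta + alpha)], negative exactly under
    the assumption on [beta]. *)
Lemma noise_to_signal_cvg0 : beta < 2 * (delta + alpha) - 1 ->
  (fun n => q n * 'C(n, 2)%:R / mu n ^+ 2) @ \oo --> (0 : R).
Proof.
move=> hbeta.
have q0 := power_law_gt0 hq; have nu0 := power_law_gt0 nu_law.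
have lim0 : (fun n => c0 ^- 2 * (q n * n%:R ^+ 2 * (nu n * nu n)^-1)) @ \oo
    --> (0 : R).
  rewrite -[X in _ --> X](mulr0 (c0 ^- 2)); apply: cvgM; first exact: cvg_cst.
  apply: (@power_law_cvg0 _ _ (- 1 + beta + 2%:R - (alpha + delta + (alpha + delta)))).
    apply: power_lawM; first exact: power_lawM hq (power_law_natX 2).
    by apply: power_lawV; apply: power_lawM.
  by lra.
apply: (squeeze_cvgr _ (cvg_cst 0) lim0).
near=> n.
have qn : 0 < q n by exact: (near q0 n).
have nun : 0 < nu n by exact: (near nu0 n).
have le_mu : c0 * nu n <= mu n by exact: (near projected_edges_ge n).
have mun : 0 < mu n by rewrite (lt_le_trans _ le_mu)// mulr_gt0.
rewrite divr_ge0 ?sqr_ge0 ?(mulr_ge0 (ltW qn))//=.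
have -> : c0 ^- 2 * (q n * n%:R ^+ 2 * (nu n * nu n)^-1)
    = (q n * n%:R ^+ 2) / (c0 * nu n) ^+ 2.
  by field; rewrite !gt_eqF.
have c0nun := mulr_gt0 c0_gt0 nun.
apply: ler_pM.
- by rewrite mulr_ge0// ltW.
- by rewrite invr_ge0 sqr_ge0.
- by rewrite ler_wpM2l ?(ltW qn)// -natrX ler_nat bin_leX.
rewrite lef_pV2 ?posrE ?exprn_gt0//.
by rewrite lerXn2r// nnegrE ltW.
Unshelve. all: by end_near. Qed.

(** For [delta + alpha > 0] the power law of [nu] forces divergence of [mu]. At exponent 0 the
    [o(1)] decides, so divergence comes from the hypothesis. *)
Lemma projected_edgesV_cvg0 : 0 <= delta + alpha ->
  (delta + alpha = 0 -> (fun n => p n * s n * 'C(n, d)%:R) @ \oo --> +oo) ->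
  (fun n => (mu n)^-1) @ \oo --> (0 : R).
Proof.
move=> da0 hdeg.
have nu0 := power_law_gt0 nu_law.
move: da0; rewrite le_eqVlt => /predU1P[/esym/hdeg psM|da0].
  apply/gtr0_cvgV0; first exact: projected_edges_gt0.
  have p0 := power_law_gt0 hp; have s0 := power_law_gt0 hs.
  apply/cvgryPge => M; near=> n.
  have pn : 0 < p n by exact: (near p0 n).
  have sn : 0 < s n by exact: (near s0 n).
  apply: le_trans (_ : p n * s n * 'C(n, d)%:R <= _).
    by near: n; move/cvgryPge : psM; apply.
  by rewrite /projected_edges ler_wpM2l ?mulr_ge0 ?(ltW pn) ?(ltW sn)// ler_peMl.
have lim0 : (fun n => c0 ^-1 * (nu n)^-1) @ \oo --> (0 : R).
  rewrite -[X in _ --> X](mulr0 (c0 ^-1)); apply: cvgM; first exact: cvg_cst.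
  by apply: power_law_cvg0 (power_lawV nu_law) _; lra.
apply: (squeeze_cvgr _ (cvg_cst 0) lim0); near=> n.
have nun : 0 < nu n by exact: (near nu0 n).
have le_mu : c0 * nu n <= mu n by exact: (near projected_edges_ge n).
have mun : 0 < mu n by rewrite (lt_le_trans _ le_mu)// mulr_gt0.
by rewrite invr_ge0 ltW//= -invfM lef_pV2 ?posrE// (mulr_gt0 c0_gt0 nun).
Unshelve. all: by end_near. Qed.

(** Bounding the binomial by [n^(d - 2)] leaves exponent [delta - 1 < 0]. *)
Lemma codegree_cvg0 : delta < 1 ->
  (fun n => 'C(n - 2, d - 2)%:R * s n) @ \oo --> (0 : R).
Proof.
move=> d1.
have lim0 : (fun n => s n * n%:R ^+ (d - 2)) @ \oo --> (0 : R).
  apply: power_law_cvg0 (power_lawM hs (power_law_natX (d - 2))) _.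
  by rewrite natrB//; lra.
apply: (squeeze_cvgr _ (cvg_cst 0) lim0).
have s0 := power_law_gt0 hs; near=> n.
have sn : 0 < s n by exact: (near s0 n).
rewrite mulr_ge0 ?(ltW sn)//= mulrC ler_wpM2l ?(ltW sn)// -natrX ler_nat.
by rewrite (leq_trans _ (bin_leX _ _))// leq_bin2l// leq_subr.
Unshelve. all: by end_near. Qed.

(** Supplies the constant [c < 1/2] that keeps the signal, about [(1 - q/p) mu], above the threshold
    excess [mu / 2]. *)
Lemma noise_ratio : (forall n, q n <= p n) ->
  (beta = alpha -> exists2 c : R, c < 2^-1 & \forall n \near \oo, q n <= c * p n) ->
  exists2 c : R, c < 2^-1 & \forall n \near \oo, q n <= c * p n.
Proof.
move=> qp hpq; have [ba|ab|ba] := ltgtP beta alpha; last exact: hpq ba.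
- exists 4^-1; first by lra.
  by apply: power_law_le hq hp _ _; lra.
(* alpha < beta contradicts q <= p. *)
- have q0 := power_law_gt0 hq.
  have pq : \forall n \near \oo, p n <= 2^-1 * q n.
    by apply: power_law_le hp hq _ _; lra.
  exists 0; first by lra.
  near=> n; have := qp n; have : 0 < q n by exact: (near q0 n).
  by have : p n <= 2^-1 * q n by [exact: (near pq n)]; lra.
Unshelve. all: by end_near. Qed.

End Asymptotics.

(** * Vanishing error probabilities and strong detection *)

Unset Implicit Arguments.
Set Strict Implicit.

(* The hypotheses hdeg and hpq are vacuous unless delta = alpha = 0,
   respectively beta = alpha, where the conclusion can fail (if the mean number
   of projected edges kept is bounded; if p = q, in which case both laws
   coincide). *)
Theorem proposition2p4 (R : realType) (d : nat) (delta alpha beta : R)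
    (s p q : nat -> R)
    (hd : (2 <= d)%N)
    (hdelta : 0 <= delta < 1) (halpha : 0 <= alpha <= 1)
    (hs01 : forall n, 0 <= s n <= 1)
    (hp1 : forall n, p n <= 1)
    (hqp : forall n, 0 <= q n <= p n)
    (hs : power_law s (- (d%:R - 1) + delta))
    (hp : power_law p (- 1 + alpha))
    (hq : power_law q (- 1 + beta))
    (hbeta : beta < 2 * (delta + alpha) - 1)
    (hdeg : delta + alpha = 0 ->
      (fun n => p n * s n * 'C(n, d)%:R) @ \oo --> +oo)
    (hpq : beta = alpha ->
      exists2 c : R, c < 2^-1 & \forall n \near \oo, q n <= c * p n) :
  [/\ (fun n => Pr (@noisy_projection_law R d (s n) (p n) (q n) n)
         (fun A => edge_threshold n d (s n) (p n) (q n) < (edge_count A)%:R))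
        @ \oo --> (1 : R),
      (fun n => Pr (@erdos_renyi_law R (q n) n)
         (fun A => (edge_count A)%:R < edge_threshold n d (s n) (p n) (q n)))
        @ \oo --> (1 : R)
    & strong_detection
        (fun n => @noisy_projection_law R d (s n) (p n) (q n) n)
        (fun n => @erdos_renyi_law R (q n) n)
        (edge_test d s p q)].

Proof.
have /andP[delta0 delta1] := hdelta; have /andP[alpha0 alpha1] := halpha.
pose mu n := @projected_edges R n d (s n) (p n).
have q0 n : 0 <= q n by have /andP[] := hqp n.
have qp n : q n <= p n by have /andP[] := hqp n.
have [c c2 qcp] := noise_ratio hp hq qp hpq.
have nts := noise_to_signal_cvg0 hd hs hp hq hbeta.
have muV := projected_edgesV_cvg0 hd hs hp (addr_ge0 delta0 alpha0) hdeg.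
have mu0 := projected_edges_gt0 hd hs hp.
pose P n := @noisy_projection_law R d (s n) (p n) (q n) n.
pose Q n := @erdos_renyi_law R (q n) n.
pose missP n := Pr (P n) (fun A =>
  ~~ (edge_threshold n d (s n) (p n) (q n) < (edge_count A)%:R)).
pose missQ n := Pr (Q n) (fun A =>
  ~~ ((edge_count A)%:R < edge_threshold n d (s n) (p n) (q n))).
have P_ge0 n A : 0 <= P n A by apply: noisy_projection_ge0.
have Q_ge0 n A : 0 <= Q n A by apply: erdos_renyi_ge0 (q0 n) (qp n) (hp1 n) A.
have missQ0 : missQ @ \oo --> (0 : R).
  have lim0 : (fun n => 4 * (q n * 'C(n, 2)%:R / mu n ^+ 2)) @ \oo --> (0 : R).
    by rewrite -[X in _ --> X](mulr0 4); apply: cvgM nts; exact: cvg_cst.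
  apply: (squeeze_cvgr _ (cvg_cst 0) lim0); near=> n; rewrite Pr_ge0//=.
  by apply: erdos_renyi_error => //; exact: (near mu0 n).
have missP0 : missP @ \oo --> (0 : R).
  have lim0 : (fun n => ((2^-1 - c) / 2) ^- 2 * (q n * 'C(n, 2)%:R / mu n ^+ 2 +
      (1 + 'C(d, 2)%:R) * (mu n)^-1)) @ \oo --> (0 : R).
    rewrite -[X in _ --> X](mulr0 (((2^-1 - c) / 2) ^- 2)).
    apply: cvgM; first exact: cvg_cst.
    rewrite -[X in _ --> X]addr0; apply: cvgD nts _.
    by rewrite -[X in _ --> X](mulr0 (1 + 'C(d, 2)%:R)); apply: cvgM muV; exact: cvg_cst.
  (* Since [c < 1/2], the tolerance on [K s] is positive and is eventually met. *)
  have eta0 : 0 < (4^-1 - c / 2) / (3 / 4 - c / 2) by rewrite divr_gt0//; lra.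
  have codeg := codegree_cvg0 hd hs delta1.
  apply: (squeeze_cvgr _ (cvg_cst 0) lim0); near=> n; rewrite Pr_ge0//=.
  apply: noisy_projection_error => //; [exact: (near mu0 n)|exact: (near qcp n)|].
  rewrite (le_trans (ler_norm _))// ltW//.
  by near: n; move/cvgr0Pnorm_lt : codeg; apply.
split.
- rewrite (_ : (fun n => _) = (fun n => 1 - missP n)).
    by rewrite -[X in _ --> X]subr0; apply: cvgB missP0; exact: cvg_cst.
  by apply/funext => n; rewrite PrC mean_noisy1.
- rewrite (_ : (fun n => _) = (fun n => 1 - missQ n)).
    by rewrite -[X in _ --> X]subr0; apply: cvgB missQ0; exact: cvg_cst.
  by apply/funext => n; rewrite PrC mean_indep1.
have sum0 : (fun n => missP n + missQ n) @ \oo --> (0 : R).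
  by rewrite -[X in _ --> X]addr0; exact: cvgD.
apply: (squeeze_cvgr _ (cvg_cst 0) sum0); near=> n.
apply/andP; split.
  by rewrite addr_ge0//; apply: Pr_ge0; [exact: P_ge0 | exact: Q_ge0].
apply: lerD.
  rewrite le_eqVlt; apply/orP; left; apply/eqP; apply: eq_bigl => A.
  by rewrite eqbF_neg.
(* Only an inequality here: a tie with the threshold counts in [missQ] although the test then
   outputs 0. *)
rewrite /missQ /Pr big_mkcond [leRHS]big_mkcond/=; apply: ler_sum => A _.
rewrite eqb_id /edge_test; case: ltP => [lt_f|_]; last by case: ifP.
by rewrite -leNgt (ltW lt_f).
Unshelve. all: by end_near. Qed.
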